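(* The structural completion $\widetilde{\mathsf{KP}}$ of Kreisel–Putnam logic $\mathsf{KP}$ is not hereditarily structurally complete.
   Context: Formulas are built from a countably infinite set of variables with the connectives $\wedge,\vee,\to,\neg$. $\mathsf{KP}$ is the least set of formulas containing intuitionistic propositional logic and the formula $(\neg p\to(q\vee r))\to((\neg p\to q)\vee(\neg p\to r))$ and closed under substitution and Modus Ponens ($\mathsf{mp}$); it is regarded as the deductive system $\langle\mathsf{KP},\{\mathsf{mp}\}\rangle$. A rule is a pair $\Gamma/A$ with $\Gamma$ a finite (possibly empty) set of formulas and $A$ a formula. A deductive system is a pair $S=\langle Ax,R\rangle$ of a nonempty set of formulas and a nonempty set of rules. For finite $\Gamma$, $\Gamma\vdash_S A$ means there is a sequence $B_1,\dots,B_n=A$ where each $B_i$ is in $\Gamma$, or is a substitution instance of a formula of $Ax$, or there is a substitution instance $\Delta/B_i$ of a rule in $R$ with $\Delta\subseteq\{B_1,\dots,B_{i-1}\}$. $L(S)=\{A:\ \vdash_S A\}$. $S'$ is a deductive extension of $S$ if $\vdash_S\subseteq\vdash_{S'}$. A rule $r$ is admissible in $S=\langle Ax,R\rangle$ if $L(\langle Ax,R\cup\{r\}\rangle)=L(S)$; $\Gamma/A$ is derivable in $S$ if $\Gamma\vdash_S A$. The structural completion of $S$ is $\widetilde{S}=\langle Ax,\widetilde{R}(S)\rangle$, where $\widetilde{R}(S)$ is the set of all rules admissible in $S$. $S$ is structurally complete if every rule admissible in $S$ is derivable in $S$; it is hereditarily structurally complete if it is structurally complete and every deductive extension of it is structurally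 complete. *)

(* Defs.v *)
From Stdlib Require Import List.
Import ListNotations.

Inductive formula : Type :=
| Var : nat -> formula
| And : formula -> formula -> formula
| Or : formula -> formula -> formula
| Imp : formula -> formula -> formula
| Neg : formula -> formula.

Declare Scope form_scope.
Delimit Scope form_scope with form.
Bind Scope form_scope with formula.
Infix "∧" := And (at level 40, left associativity) : form_scope.
Infix "∨" := Or (at level 50, left associativity) : form_scope.
Infix "→" := Imp (at level 55, right associativity) : form_scope.
Notation "¬ A" := (Neg A) (at level 35, right associativity) : form_scope.
Local Open Scope form_scope.

Fixpoint subst (σ : nat -> formula) (A : formula) : formula :=
  match A with
  | Var n => σ n
  | B ∧ C => subst σ B ∧ subst σ C
  | B ∨ C => subst σ B ∨ subst σ C
  | B → C => subst σ B → subst σ C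
  | ¬ B => ¬ subst σ B
  end.

(* [Γ / A] is the pair [(Γ, A)].  The list Γ stands for the finite set of its
   members: premises are only ever used through [In] and [incl], so order and
   repetitions are irrelevant. *)
Definition rule : Type := (list formula * formula)%type.

Record deductive_system : Type := DeductiveSystem {
  axioms : formula -> Prop;
  rules : rule -> Prop;
  axioms_nonempty : exists A, axioms A;
  rules_nonempty : exists r, rules r
}.

Definition axiom_instance (S : deductive_system) (B : formula) : Prop :=
  exists (C : formula) (σ : nat -> formula), axioms S C /\ B = subst σ C.

Definition rule_instance (S : deductive_system) (Δ : list formula)
    (B : formula) : Prop :=
  exists (Δ0 : list formula) (C : formula) (σ : nat -> formula),
    rules S (Δ0, C) /\ Δ = map (subst σ) Δ0 /\ B = subst σ C.

Definition derivation (S : deductive_system) (Γ Bs : list formula) : Prop :=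
  forall (prev : list formula) (B : formula) (next : list formula),
    Bs = prev ++ B :: next ->
    In B Γ \/ axiom_instance S B \/
    exists Δ : list formula, rule_instance S Δ B /\ incl Δ prev.

Definition derives (S : deductive_system) (Γ : list formula)
    (A : formula) : Prop :=
  exists Bs : list formula, derivation S Γ (Bs ++ [A]).

Definition theorems (S : deductive_system) (A : formula) : Prop :=
  derives S [] A.

Definition deductive_extension (S S' : deductive_system) : Prop :=
  forall (Γ : list formula) (A : formula), derives S Γ A -> derives S' Γ A.

Definition add_rule (S : deductive_system) (r : rule) : deductive_system := {|
  axioms := axioms S;
  rules := fun r' => rules S r' \/ r' = r;
  axioms_nonempty := axioms_nonempty S;
  rules_nonempty := ex_intro _ r (or_intror eq_refl)
|}.

Definition admissible (S : deductive_system) (r : rule) : Prop :=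
  forall A : formula, theorems (add_rule S r) A <-> theorems S A.

Definition derivable (S : deductive_system) (r : rule) : Prop :=
  derives S (fst r) (snd r).

Lemma rules_admissible (S : deductive_system) (r : rule) :
  rules S r -> admissible S r.
Proof.
intros Hr A; split; intros [Bs HBs]; exists Bs; intros prev B next E;
  destruct (HBs prev B next E)
    as [H | [H | (Δ & (Δ0 & C & σ & HR & E1 & E2) & H)]].
- now left.
- now right; left.
- right; right; exists Δ; split; [exists Δ0, C, σ | exact H].
  destruct HR as [HR | HR]; [now auto | rewrite HR; auto].
- now left.
- now right; left.
- right; right; exists Δ; split; [exists Δ0, C, σ | exact H].
  split; [now left | auto].
Qed.

Lemma admissible_nonempty (S : deductive_system) : exists r, admissible S r.
Proof.
destruct (rules_nonempty S) as [r Hr].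
exists r; exact (rules_admissible S r Hr).
Qed.

Definition structural_completion (S : deductive_system) : deductive_system := {|
  axioms := axioms S;
  rules := admissible S;
  axioms_nonempty := axioms_nonempty S;
  rules_nonempty := admissible_nonempty S
|}.

Definition structurally_complete (S : deductive_system) : Prop :=
  forall r : rule, admissible S r -> derivable S r.

Definition hereditarily_structurally_complete (S : deductive_system) : Prop :=
  structurally_complete S /\
  forall S' : deductive_system,
    deductive_extension S S' -> structurally_complete S'.

(* Heyting's Hilbert-style calculus with primitive negation; the axioms are
   schemes, so the set is closed under substitution. *)
Inductive IPC : formula -> Prop :=
| ipc_K A B : IPC (A → B → A)
| ipc_S A B C : IPC ((A → B → C) → (A → B) → A → C)
| ipc_andI A B : IPC (A → B → A ∧ B)
| ipc_andE1 A B : IPC (A ∧ B → A)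
| ipc_andE2 A B : IPC (A ∧ B → B)
| ipc_orI1 A B : IPC (A → A ∨ B)
| ipc_orI2 A B : IPC (B → A ∨ B)
| ipc_orE A B C : IPC ((A → C) → (B → C) → A ∨ B → C)
| ipc_negI A B : IPC ((A → B) → (A → ¬ B) → ¬ A)
| ipc_negE A B : IPC (¬ A → A → B)
| ipc_mp A B : IPC (A → B) -> IPC A -> IPC B.

Definition p : formula := Var 0.
Definition q : formula := Var 1.
Definition r : formula := Var 2.

Definition kreisel_putnam : formula :=
  (¬ p → (q ∨ r)) → ((¬ p → q) ∨ (¬ p → r)).

Inductive KP : formula -> Prop :=
| KP_ipc A : IPC A -> KP A
| KP_axiom : KP kreisel_putnam
| KP_subst σ A : KP A -> KP (subst σ A)
| KP_mp A B : KP (A → B) -> KP A -> KP B.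

Definition mp : rule := ([p; p → q], q).

Definition KP_system : deductive_system := {|
  axioms := KP;
  rules := fun ρ => ρ = mp;
  axioms_nonempty := ex_intro _ kreisel_putnam KP_axiom;
  rules_nonempty := ex_intro _ mp eq_refl
|}.

(* Main.v *)
(* Let M be the Medvedev frame of nonempty subsets of a three-element set.
   Substituting disjunctions of negated formulas for the variables turns every
   formula into such a disjunction, provably in KP: this is what the
   Kreisel-Putnam axiom is for.  By Glivenko's theorem such a disjunction in two
   variables is provable as soon as it holds at the root of M, when the maximal
   worlds realise all the relevant classical valuations.  Let T be the image of
   M under identification of its maximal worlds: a root, three incomparable
   worlds, a top.  The preimages of the upsets of T are defined by disjunctions
   of negations, so every rule admissible in KP is valid in T, and the system
   whose rules are those valid in T extends the structural completion of KP.
   It is not structurally complete: a rule whose premises force three formulas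
   to be separated by the middle worlds of T is refuted in T, but no
   substitution makes the premises valid and the conclusion not, since
   identifying the valuations of two middle worlds would falsify a premise. *)

From Stdlib Require Import List Bool.
Require Import Defs.
Import ListNotations.
Local Open Scope form_scope.

(** * Substitution *)

Lemma subst_Var (A : formula) : subst Var A = A.
Proof. induction A; simpl; congruence. Qed.

Lemma map_subst_Var (Γ : list formula) : map (subst Var) Γ = Γ.
Proof.
rewrite (map_ext _ (fun A => A)) by apply subst_Var.
apply map_id.
Qed.

Lemma subst_subst (σ τ : nat -> formula) (A : formula) :
  subst τ (subst σ A) = subst (fun n => subst τ (σ n)) A.
Proof. induction A; simpl; congruence. Qed.

(** * Deductive systems *)

(** A derivation sequence hides an induction: all members of each prefix satisfy [P], by induction
    on the prefix from its right end. *)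
Lemma derives_ind (S : deductive_system) (Γ : list formula)
    (P : formula -> Prop) :
  (forall A, In A Γ -> P A) ->
  (forall A, axiom_instance S A -> P A) ->
  (forall Δ A, rule_instance S Δ A -> (forall B, In B Δ -> P B) -> P A) ->
  forall A, derives S Γ A -> P A.
Proof.
intros HΓ HAx HR A [Bs HBs].
assert (H : forall Cs next, Bs ++ [A] = Cs ++ next ->
  forall C, In C Cs -> P C).
{ induction Cs as [|C Cs IH] using rev_ind; [easy|].
  intros next E D HD.
  rewrite <- app_assoc in E; simpl in E.
  apply in_app_or in HD; destruct HD as [HD | [<- | []]].
  - exact (IH _ E _ HD).
  - destruct (HBs _ _ _ E) as [? | [? | (Δ & ? & HΔ)]]; auto.
    apply (HR Δ); auto.
    intros B HB; exact (IH _ E _ (HΔ B HB)). }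
apply (H (Bs ++ [A]) []); [now rewrite app_nil_r|].
apply in_or_app; right; now left.
Qed.

(** The list [Δ ++ [A]] is already a derivation. *)
Lemma derives_rule_instance (S : deductive_system) (Γ Δ : list formula)
    (A : formula) :
  rule_instance S Δ A ->
  (forall B, In B Δ -> In B Γ \/ axiom_instance S B) -> derives S Γ A.
Proof.
intros HR HΔ; exists Δ; intros prev B next E.
destruct next as [|C next _] using rev_ind.
- apply app_inj_tail in E; destruct E as [-> ->].
  right; right; exists prev; split; [exact HR | apply incl_refl].
- rewrite app_comm_cons, app_assoc in E.
  apply app_inj_tail in E; destruct E as [-> _].
  destruct (HΔ B) as [H | H]; auto.
  apply in_or_app; right; now left.
Qed.

Lemma KP_system_theorems (A : formula) : theorems KP_system A -> KP A.
Proof.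
apply derives_ind; [easy| |].
- intros B (C & σ & HC & ->); now apply KP_subst.
- intros Δ B (Δ0 & C & σ & E & -> & ->) H; injection E as -> ->.
  apply (KP_mp (σ 0)); apply H; simpl; auto.
Qed.

(** The substituted premises belong to [KP], hence are axioms of the system; one application of the
    added rule gives the conclusion, and admissibility then eliminates that rule. *)
Lemma KP_admissible (Γ : list formula) (A : formula) (σ : nat -> formula) :
  admissible KP_system (Γ, A) ->
  (forall B, In B Γ -> KP (subst σ B)) -> KP (subst σ A).
Proof.
intros Hadm HΓ; apply KP_system_theorems, Hadm.
apply derives_rule_instance with (Δ := map (subst σ) Γ).
- exists Γ, A, σ; simpl; auto.
- intros B HB; right; exists B, Var.
  rewrite subst_Var; split; [|easy].
  apply in_map_iff in HB; destruct HB as (C & <- & HC); now apply HΓ.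
Qed.

(** * Natural deduction for KP *)

(** Substitution acts only inside [KP], never on hypotheses, so that the deduction theorem holds. *)
Inductive entails (Γ : list formula) : formula -> Prop :=
| entails_hyp A : In A Γ -> entails Γ A
| entails_KP A : KP A -> entails Γ A
| entails_mp A B : entails Γ (A → B) -> entails Γ A -> entails Γ B.

Lemma entails_nil (A : formula) : entails [] A -> KP A.
Proof. induction 1; [easy | easy | eapply KP_mp; eauto]. Qed.

Lemma entails_incl (Γ Δ : list formula) (A : formula) :
  incl Γ Δ -> entails Γ A -> entails Δ A.
Proof.
intros HΓ; induction 1;
  [apply entails_hyp; auto | now apply entails_KP | eapply entails_mp; eauto].
Qed.

Lemma entails_imp (Γ : list formula) (A B : formula) :
  entails (A :: Γ) B -> entails Γ (A → B).
Proof.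
induction 1 as [B HB | B HB | B C _ IH1 _ IH2].
- destruct HB as [<- | HB].
  + apply entails_KP, KP_ipc.
    exact (ipc_mp _ _ (ipc_mp _ _ (ipc_S A (A → A) A) (ipc_K _ _))
      (ipc_K _ _)).
  + eapply entails_mp; [apply entails_KP, KP_ipc, ipc_K | now apply entails_hyp].
- eapply entails_mp; [apply entails_KP, KP_ipc, ipc_K | now apply entails_KP].
- eapply entails_mp; [eapply entails_mp; [|exact IH1] | exact IH2].
  apply entails_KP, KP_ipc, ipc_S.
Qed.

Lemma entails_impE (Γ : list formula) (A B : formula) :
  entails Γ (A → B) -> entails (A :: Γ) B.
Proof.
intros H; apply entails_mp with A; [|apply entails_hyp; now left].
apply entails_incl with Γ; [now right | exact H].
Qed.

Lemma entails_cut (Γ : list formula) (A B : formula) :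
  entails Γ A -> entails (A :: Γ) B -> entails Γ B.
Proof. intros HA HB; exact (entails_mp _ _ _ (entails_imp _ _ _ HB) HA). Qed.

Lemma entails_and (Γ : list formula) (A B : formula) :
  entails Γ A -> entails Γ B -> entails Γ (A ∧ B).
Proof.
intros HA HB; eapply entails_mp; [eapply entails_mp; [|exact HA] | exact HB].
apply entails_KP, KP_ipc, ipc_andI.
Qed.

Lemma entails_andL (Γ : list formula) (A B C : formula) :
  entails (A :: B :: Γ) C -> entails (A ∧ B :: Γ) C.
Proof.
intros H.
apply entails_cut with B.
- apply entails_impE, entails_KP, KP_ipc, ipc_andE2.
- apply entails_cut with A.
  + apply entails_incl with (A ∧ B :: Γ); [now right|].
    apply entails_impE, entails_KP, KP_ipc, ipc_andE1.
  + apply entails_incl with (2 := H).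
    intros D [<- | [<- | HD]]; simpl; auto.
Qed.

Lemma entails_or1 (Γ : list formula) (A B : formula) :
  entails Γ A -> entails Γ (A ∨ B).
Proof. apply entails_mp, entails_KP, KP_ipc, ipc_orI1. Qed.

Lemma entails_or2 (Γ : list formula) (A B : formula) :
  entails Γ B -> entails Γ (A ∨ B).
Proof. apply entails_mp, entails_KP, KP_ipc, ipc_orI2. Qed.

Lemma entails_orL (Γ : list formula) (A B C : formula) :
  entails (A :: Γ) C -> entails (B :: Γ) C -> entails (A ∨ B :: Γ) C.
Proof.
intros HA HB; apply entails_impE.
eapply entails_mp; [eapply entails_mp|]; [|exact (entails_imp _ _ _ HA)|
  exact (entails_imp _ _ _ HB)].
apply entails_KP, KP_ipc, ipc_orE.
Qed.

Lemma entails_absurd (Γ : list formula) (A B : formula) :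
  entails Γ (¬ A) -> entails Γ A -> entails Γ B.
Proof.
intros HN HA; eapply entails_mp; [eapply entails_mp; [|exact HN] | exact HA].
apply entails_KP, KP_ipc, ipc_negE.
Qed.

(** The language has no falsum, so a refutation of [A] takes the form of a derivation of [¬ A] from
    [A]; [entails_absurd] produces one from any contradiction. *)
Lemma entails_neg (Γ : list formula) (A : formula) :
  entails (A :: Γ) (¬ A) -> entails Γ (¬ A).
Proof.
intros H; eapply entails_mp; [eapply entails_mp|].
- apply entails_KP, KP_ipc, (ipc_negI A A).
- apply entails_imp, entails_hyp; now left.
- now apply entails_imp.
Qed.

(** The one place in the calculus where the Kreisel-Putnam axiom is applied. *)
Lemma entails_split (Γ : list formula) (A B C : formula) :
  entails (¬ A → B ∨ C :: Γ) ((¬ A → B) ∨ (¬ A → C)).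
Proof.
apply entails_impE, entails_KP.
exact (KP_subst (fun n => match n with 0 => A | 1 => B | _ => C end) _ KP_axiom).
Qed.

Ltac hyp := apply entails_hyp; simpl; tauto.

(** * Provable equivalence and the laws behind the normal form *)

Definition equivalent (A B : formula) : Prop :=
  entails [A] B /\ entails [B] A.

Lemma equivalent_refl (A : formula) : equivalent A A.
Proof. split; hyp. Qed.

Lemma entails_left (Γ : list formula) (A B C : formula) :
  entails [A] B -> entails (B :: Γ) C -> entails (A :: Γ) C.
Proof.
intros H1 H2; apply entails_cut with B.
- apply entails_incl with (2 := H1); intros D [<- | []]; now left.
- apply entails_incl with (2 := H2); intros D [<- | HD]; simpl; auto.
Qed.

Lemma equivalent_trans (A B C : formula) :
  equivalent A B -> equivalent B C -> equivalent A C.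
Proof.
intros [H1 H2] [H3 H4]; split; eapply entails_left; eauto.
Qed.

Lemma equivalent_and (A A' B B' : formula) :
  equivalent A A' -> equivalent B B' -> equivalent (A ∧ B) (A' ∧ B').
Proof.
intros [H1 H2] [H3 H4].
split; apply entails_andL, entails_and.
1, 3: eapply entails_left; [eassumption | hyp].
all: eapply entails_incl; [|eassumption]; intros D [<- | []]; simpl; auto.
Qed.

Lemma equivalent_or (A A' B B' : formula) :
  equivalent A A' -> equivalent B B' -> equivalent (A ∨ B) (A' ∨ B').
Proof.
intros [H1 H2] [H3 H4].
split; apply entails_orL; (apply entails_or1; assumption) ||
  (apply entails_or2; assumption).
Qed.

Lemma entails_imp_mono (A A' B B' : formula) :
  entails [A'] A -> entails [B] B' -> entails [A → B] (A' → B').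
Proof.
intros HA HB; apply entails_imp, entails_cut with B.
- apply entails_mp with A; [hyp|].
  apply entails_incl with (2 := HA); intros D [<- | []]; now left.
- apply entails_incl with (2 := HB); intros D [<- | []]; now left.
Qed.

Lemma equivalent_imp (A A' B B' : formula) :
  equivalent A A' -> equivalent B B' -> equivalent (A → B) (A' → B').
Proof. intros [] []; split; now apply entails_imp_mono. Qed.

Lemma neg_or (A B : formula) : equivalent (¬ A ∧ ¬ B) (¬ (A ∨ B)).
Proof.
split.
- apply entails_andL, entails_neg, entails_orL;
    [apply entails_absurd with A | apply entails_absurd with B]; hyp.
- apply entails_and; apply entails_neg, entails_absurd with (A ∨ B); try hyp;
    [apply entails_or1 | apply entails_or2]; hyp.
Qed.

Lemma neg_imp (A B : formula) : equivalent (¬ A → ¬ B) (¬ (¬ A ∧ B)).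
Proof.
split.
- apply entails_neg, entails_andL, entails_absurd with B; [|hyp].
  apply entails_mp with (¬ A); hyp.
- apply entails_imp, entails_neg, entails_absurd with (¬ A ∧ B); [hyp|].
  apply entails_and; hyp.
Qed.

Lemma and_comm_equivalent (A B : formula) : equivalent (A ∧ B) (B ∧ A).
Proof. split; apply entails_andL, entails_and; hyp. Qed.

Lemma or_and (A B C : formula) : equivalent ((A ∨ B) ∧ C) (A ∧ C ∨ B ∧ C).
Proof.
split.
- apply entails_andL, entails_orL;
    [apply entails_or1 | apply entails_or2]; apply entails_and; hyp.
- apply entails_orL; apply entails_andL, entails_and; try hyp;
    [apply entails_or1 | apply entails_or2]; hyp.
Qed.

Lemma or_imp (A B C : formula) : equivalent (A ∨ B → C) ((A → C) ∧ (B → C)).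
Proof.
split.
- apply entails_and; apply entails_imp, entails_mp with (A ∨ B); try hyp;
    [apply entails_or1 | apply entails_or2]; hyp.
- apply entails_andL, entails_imp, entails_orL;
    [apply entails_mp with A | apply entails_mp with B]; hyp.
Qed.

Lemma neg_imp_or (A B C : formula) :
  equivalent (¬ A → B ∨ C) ((¬ A → B) ∨ (¬ A → C)).
Proof.
split; [apply entails_split|].
apply entails_orL; apply entails_imp;
  [apply entails_or1 | apply entails_or2]; apply entails_mp with (¬ A); hyp.
Qed.

(** * Disjunctions of negations *)

Inductive neg_disj : formula -> Prop :=
| neg_disj_neg A : neg_disj (¬ A)
| neg_disj_or A B : neg_disj A -> neg_disj B -> neg_disj (A ∨ B).

Definition has_neg_disj (A : formula) : Prop :=
  exists B, neg_disj B /\ equivalent A B.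

Lemma has_neg_disj_equivalent (A B : formula) :
  equivalent A B -> has_neg_disj B -> has_neg_disj A.
Proof.
intros H (C & HC & HBC); exists C; split; [exact HC|].
exact (equivalent_trans _ _ _ H HBC).
Qed.

Lemma has_neg_disj_neg (A : formula) : has_neg_disj (¬ A).
Proof. exists (¬ A); split; [constructor | apply equivalent_refl]. Qed.

Lemma has_neg_disj_or (A B : formula) :
  has_neg_disj A -> has_neg_disj B -> has_neg_disj (A ∨ B).
Proof.
intros (A' & HA & EA) (B' & HB & EB).
exists (A' ∨ B'); split; [now constructor | now apply equivalent_or].
Qed.

Lemma has_neg_disj_and (A B : formula) :
  has_neg_disj A -> has_neg_disj B -> has_neg_disj (A ∧ B).
Proof.
intros (A' & HA & EA) (B' & HB & EB).
apply has_neg_disj_equivalent with (A' ∧ B'); [now apply equivalent_and|].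
clear - HA HB; induction HA as [A|A1 A2 _ IH1 _ IH2].
- induction HB as [B|B1 B2 _ IH1 _ IH2].
  + eapply has_neg_disj_equivalent; [apply neg_or | apply has_neg_disj_neg].
  + eapply has_neg_disj_equivalent; [apply and_comm_equivalent|].
    eapply has_neg_disj_equivalent; [apply or_and|].
    apply has_neg_disj_or;
      (eapply has_neg_disj_equivalent; [apply and_comm_equivalent|assumption]).
- eapply has_neg_disj_equivalent; [apply or_and | now apply has_neg_disj_or].
Qed.

(** A disjunctive antecedent splits the implication into a conjunction; a negated antecedent
    distributes over a disjunctive consequent by the Kreisel-Putnam axiom; between two negations the
    implication is itself a negation. *)
Lemma has_neg_disj_imp (A B : formula) :
  has_neg_disj A -> has_neg_disj B -> has_neg_disj (A → B).
Proof.
intros (A' & HA & EA) (B' & HB & EB).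
apply has_neg_disj_equivalent with (A' → B'); [now apply equivalent_imp|].
clear - HA HB; induction HA as [A|A1 A2 _ IH1 _ IH2].
- induction HB as [B|B1 B2 _ IH1 _ IH2].
  + eapply has_neg_disj_equivalent; [apply neg_imp | apply has_neg_disj_neg].
  + eapply has_neg_disj_equivalent; [apply neg_imp_or|].
    now apply has_neg_disj_or.
- eapply has_neg_disj_equivalent; [apply or_imp | now apply has_neg_disj_and].
Qed.

Lemma has_neg_disj_subst (σ : nat -> formula) (A : formula) :
  (forall n, neg_disj (σ n)) -> has_neg_disj (subst σ A).
Proof.
intros Hσ; induction A; simpl.
- exists (σ n); split; [apply Hσ | apply equivalent_refl].
- now apply has_neg_disj_and.
- now apply has_neg_disj_or.
- now apply has_neg_disj_imp.
- apply has_neg_disj_neg.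
Qed.

(** * Kripke frames *)

(** A finite list of worlds and a boolean relation make forcing a computable boolean, so facts about
    concrete frames reduce to evaluation. *)
Record frame : Type := Frame {
  world :> Type;
  acc : world -> world -> bool;
  worlds : list world;
  worlds_complete : forall w, In w worlds;
  acc_refl : forall w, acc w w = true;
  acc_trans : forall w u t, acc w u = true -> acc u t = true -> acc w t = true
}.

Arguments acc {f}.

Fixpoint forces (F : frame) (v : nat -> F -> bool) (w : F) (A : formula)
    : bool :=
  match A with
  | Var n => v n w
  | B ∧ C => forces F v w B && forces F v w C
  | B ∨ C => forces F v w B || forces F v w C
  | B → C => forallb
      (fun u => implb (acc w u) (implb (forces F v u B) (forces F v u C)))
      (worlds F)
  | ¬ B => forallb
      (fun u => implb (acc w u) (negb (forces F v u B))) (worlds F)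
  end.

Arguments forces {F}.

Definition persistent {F : frame} (v : nat -> F -> bool) : Prop :=
  forall n w u, acc w u = true -> v n w = true -> v n u = true.

Lemma forces_imp {F : frame} (v : nat -> F -> bool) (w : F) (A B : formula) :
  forces v w (A → B) = true <->
  forall u, acc w u = true -> forces v u A = true -> forces v u B = true.
Proof.
simpl; rewrite forallb_forall; split.
- intros H u Hwu HA; specialize (H u (worlds_complete F u)).
  now rewrite Hwu, HA in H.
- intros H u _; specialize (H u).
  destruct (acc w u), (forces v u A); simpl; auto.
Qed.

Lemma forces_neg {F : frame} (v : nat -> F -> bool) (w : F) (A : formula) :
  forces v w (¬ A) = true <->
  forall u, acc w u = true -> forces v u A = true -> False.
Proof.
simpl; rewrite forallb_forall; split.
- intros H u Hwu HA; specialize (H u (worlds_complete F u)).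
  now rewrite Hwu, HA in H.
- intros H u _; specialize (H u).
  destruct (acc w u), (forces v u A); simpl; auto; now destruct H.
Qed.

Lemma forces_and {F : frame} (v : nat -> F -> bool) (w : F) (A B : formula) :
  forces v w (A ∧ B) = true <-> forces v w A = true /\ forces v w B = true.
Proof. apply andb_true_iff. Qed.

Lemma forces_or {F : frame} (v : nat -> F -> bool) (w : F) (A B : formula) :
  forces v w (A ∨ B) = true <-> forces v w A = true \/ forces v w B = true.
Proof. apply orb_true_iff. Qed.

Lemma forces_persistent {F : frame} (v : nat -> F -> bool) (w u : F)
    (A : formula) :
  persistent v -> acc w u = true -> forces v w A = true -> forces v u A = true.
Proof.
intros Hv; revert w u; induction A as [n|A IHA B IHB|A IHA B IHB|A IHA B IHB|A IHA];
  intros w u Hwu.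
- apply Hv, Hwu.
- rewrite !forces_and; intros []; eauto.
- rewrite !forces_or; intros []; eauto.
- rewrite !forces_imp; eauto using acc_trans.
- rewrite !forces_neg; eauto using acc_trans.
Qed.

Lemma forces_ext {F : frame} (v v' : nat -> F -> bool) (w : F) (A : formula) :
  (forall n u, v n u = v' n u) -> forces v w A = forces v' w A.
Proof.
intros E; revert w; induction A as [n|A IHA B IHB|A IHA B IHB|A IHA B IHB|A IHA];
  intros w; simpl.
- apply E.
- now rewrite IHA, IHB.
- now rewrite IHA, IHB.
- induction (worlds F); simpl; congruence.
- induction (worlds F); simpl; congruence.
Qed.

Lemma forces_subst {F : frame} (v : nat -> F -> bool) (σ : nat -> formula)
    (w : F) (A : formula) :
  forces v w (subst σ A) = forces (fun n u => forces v u (σ n)) w A.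
Proof.
revert w; induction A as [n|A IHA B IHB|A IHA B IHB|A IHA B IHB|A IHA];
  intros w; simpl.
- easy.
- now rewrite IHA, IHB.
- now rewrite IHA, IHB.
- induction (worlds F); simpl; congruence.
- induction (worlds F); simpl; congruence.
Qed.

Lemma persistent_subst {F : frame} (v : nat -> F -> bool) (σ : nat -> formula) :
  persistent v -> persistent (fun n u => forces v u (σ n)).
Proof. intros Hv n w u; now apply forces_persistent. Qed.

Lemma bool_iff (a b : bool) : (a = true <-> b = true) -> a = b.
Proof. destruct a, b; intuition congruence. Qed.

Lemma forces_p_morphism {F G : frame} (f : F -> G) (v : nat -> G -> bool)
    (w : F) (A : formula) :
  (forall w u, acc w u = true -> acc (f w) (f u) = true) ->
  (forall w t, acc (f w) t = true -> exists u, acc w u = true /\ f u = t) ->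
  forces (fun n u => v n (f u)) w A = forces v (f w) A.
Proof.
intros forth back.
revert w; induction A as [n|A IHA B IHB|A IHA B IHB|A IHA B IHB|A IHA];
  intros w.
- easy.
- simpl; now rewrite IHA, IHB.
- simpl; now rewrite IHA, IHB.
- apply bool_iff; rewrite !forces_imp; split; intros H u Hu.
  + destruct (back _ _ Hu) as (u' & Hu' & <-); rewrite <- IHA, <- IHB; auto.
  + rewrite IHA, IHB; auto.
- apply bool_iff; rewrite !forces_neg; split; intros H u Hu.
  + destruct (back _ _ Hu) as (u' & Hu' & <-); rewrite <- IHA; eauto.
  + rewrite IHA; eauto.
Qed.

Lemma IPC_sound (F : frame) (v : nat -> F -> bool) (w : F) (A : formula) :
  persistent v -> IPC A -> forces v w A = true.
Proof.
intros Hv HA; revert w; induction HA; intros w.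
- rewrite forces_imp; intros u Hu HA.
  rewrite forces_imp; intros t Ht _; eauto using forces_persistent.
- rewrite forces_imp; intros u Hu HABC.
  rewrite forces_imp; intros t Ht HAB.
  rewrite forces_imp; intros s Hs HA.
  rewrite forces_imp in HABC, HAB.
  specialize (HABC s (acc_trans _ _ _ _ Ht Hs) HA).
  rewrite forces_imp in HABC; apply HABC; auto using acc_refl.
- rewrite forces_imp; intros u Hu HA.
  rewrite forces_imp; intros t Ht HB.
  rewrite forces_and; eauto using forces_persistent.
- rewrite forces_imp; intros u Hu; rewrite forces_and; tauto.
- rewrite forces_imp; intros u Hu; rewrite forces_and; tauto.
- rewrite forces_imp; intros u Hu; rewrite forces_or; tauto.
- rewrite forces_imp; intros u Hu; rewrite forces_or; tauto.
- rewrite forces_imp; intros u Hu HAC.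
  rewrite forces_imp; intros t Ht HBC.
  rewrite forces_imp; intros s Hs HAB.
  rewrite forces_imp in HAC, HBC; rewrite forces_or in HAB.
  destruct HAB; eauto using acc_trans.
- rewrite forces_imp; intros u Hu HAB.
  rewrite forces_imp; intros t Ht HAnB.
  rewrite forces_neg; intros s Hs HA.
  rewrite forces_imp in HAB, HAnB.
  specialize (HAnB s Hs HA); rewrite forces_neg in HAnB.
  apply (HAnB s); eauto using acc_refl, acc_trans.
- rewrite forces_imp; intros u Hu HnA.
  rewrite forces_imp; intros t Ht HA.
  rewrite forces_neg in HnA; destruct (HnA t Ht HA).
- specialize (IHHA1 w); rewrite forces_imp in IHHA1.
  apply IHHA1; auto using acc_refl.
Qed.

(** * The Medvedev frame on three points *)

Inductive med_world : Type := M1 | M2 | M3 | M12 | M13 | M23 | M123.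

Definition members (w : med_world) : list bool :=
  match w with
  | M1 => [true; false; false]
  | M2 => [false; true; false]
  | M3 => [false; false; true]
  | M12 => [true; true; false]
  | M13 => [true; false; true]
  | M23 => [false; true; true]
  | M123 => [true; true; true]
  end.

(** Reverse inclusion: the full set is the root and the singletons are maximal. *)
Definition med_acc (w u : med_world) : bool :=
  forallb (fun bc => implb (fst bc) (snd bc)) (combine (members u) (members w)).

Definition med : frame.
Proof.
refine (Frame med_world med_acc [M1; M2; M3; M12; M13; M23; M123] _ _ _).
- intros []; simpl; tauto.
- intros []; reflexivity.
- intros [] [] []; reflexivity || discriminate.
Defined.

(** The default branch catches only the full set, since a union of nonempty sets is nonempty. *)
Definition med_union (w u : med_world) : med_world :=
  match map (fun bc => orb (fst bc) (snd bc)) (combine (members w) (members u))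
  with
  | [true; false; false] => M1
  | [false; true; false] => M2
  | [false; false; true] => M3
  | [true; true; false] => M12
  | [true; false; true] => M13
  | [false; true; true] => M23
  | _ => M123
  end.

Lemma med_union_greatest (w u t : med) :
  acc t w = true -> acc t u = true -> acc t (med_union w u) = true.
Proof. destruct w, u, t; reflexivity || discriminate. Qed.

Lemma med_union_acc (w u : med) :
  acc (med_union w u : med) w = true /\ acc (med_union w u : med) u = true.
Proof. destruct w, u; now split. Qed.

(** Any point of [t] lies in [w] or in [u]; its singleton serves as [s]. *)
Lemma med_union_below (w u t : med) :
  acc (med_union w u : med) t = true ->
  exists s : med, acc t s = true /\ (acc w s = true \/ acc u s = true).
Proof.
destruct w, u, t; try discriminate; intros _;
  solve [ exists M1; simpl; auto | exists M2; simpl; auto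
        | exists M3; simpl; auto ].
Qed.

(** For the Kreisel-Putnam axiom, suppose both disjuncts fail, at worlds [u] and [t]. Their union
    still forces [¬ p], because every world it sees shares a successor with [u] or [t]; hence it
    forces [q] or [r], and persistence contradicts the choice of [u] or [t]. *)
Lemma KP_sound (v : nat -> med -> bool) (w : med) (A : formula) :
  persistent v -> KP A -> forces v w A = true.
Proof.
intros Hv HA; revert v Hv w; induction HA as [A HA| |σ A _ IH|A B _ IH1 _ IH2];
  intros v Hv w.
- now apply IPC_sound.
- revert w; intros w0; apply forces_imp; intros w _ Hw; clear w0.
  rewrite forces_imp in Hw.
  destruct (forces v w ((¬ p → q) ∨ (¬ p → r))) eqn:E; [easy|exfalso].
  (* Finiteness turns the failure of an implication into an explicit refuting world. *)
  assert (H : forall B, forces v w (¬ p → B) = false ->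
    exists u, acc w u = true /\ forces v u (¬ p) = true /\ forces v u B = false).
  { intros B HB.
    assert (H : existsb (fun u => acc w u && forces v u (¬ p)
        && negb (forces v u B)) (worlds med) = true).
    { rewrite <- not_false_iff_true; intros H.
      apply not_true_iff_false in HB; apply HB, forces_imp; intros u Hu Hp.
      rewrite <- not_true_iff_false in H.
      destruct (forces v u B) eqn:HuB; [easy|].
      destruct H; apply existsb_exists; exists u.
      split; [apply worlds_complete|].
      rewrite Hu, Hp, HuB; reflexivity. }
    apply existsb_exists in H; destruct H as (u & _ & Hu).
    rewrite !andb_true_iff, negb_true_iff in Hu; exists u; tauto. }
  change (forces v w (¬ p → q) || forces v w (¬ p → r) = false) in E.
  apply orb_false_iff in E; destruct E as [Eq Er].
  destruct (H _ Eq) as (u & Hu & Hup & Huq).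
  destruct (H _ Er) as (t & Ht & Htp & Htr).
  destruct (med_union_acc u t) as [Hu' Ht'].
  assert (Hp : forces v (med_union u t : med) (¬ p) = true).
  { rewrite forces_neg in Hup, Htp |- *; intros s Hs Hsp.
    destruct (med_union_below u t s Hs) as (s' & Hss' & [Hs' | Hs']);
      [apply (Hup s' Hs') | apply (Htp s' Hs')];
      exact (forces_persistent _ _ _ _ Hv Hss' Hsp). }
  apply (Hw (med_union u t : med)) in Hp; [|now apply med_union_greatest].
  apply forces_or in Hp; destruct Hp as [Hp | Hp];
    [apply (forces_persistent _ _ _ _ Hv Hu') in Hp |
     apply (forces_persistent _ _ _ _ Hv Ht') in Hp]; congruence.
- rewrite forces_subst; now apply IH, persistent_subst.
- specialize (IH1 v Hv w); rewrite forces_imp in IH1.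
  apply IH1; auto using acc_refl.
Qed.

(** The maximal worlds [M1], [M2], [M3] make true, respectively, no variable, only [p], and every
    variable. *)
Definition generic (n : nat) (w : med) : bool :=
  match n, w with
  | 0, (M2 | M3 | M23) => true
  | S _, M3 => true
  | _, _ => false
  end.

(** Replacing all other variables by [p ∧ q] excludes the classical valuation with [p] false and [q]
    true, which no maximal world realises. *)
Definition collapse (n : nat) : formula :=
  match n with 0 => p | S _ => p ∧ q end.

Lemma generic_persistent : persistent generic.
Proof. intros [|n] [] []; reflexivity || discriminate. Qed.

Lemma forces_collapse (w : med) (A : formula) :
  forces generic w (subst collapse A) = forces generic w A.
Proof.
rewrite forces_subst; apply forces_ext; intros [|n] []; reflexivity.
Qed.

(* Kalmár's lemma: a context deciding the variables as a maximal world does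
   decides every formula as that world does. *)
Lemma entails_maximal {F : frame} (v : nat -> F -> bool) (w : F)
    (Γ : list formula) (σ : nat -> formula) (A : formula) :
  (forall u, acc w u = true -> u = w) ->
  (forall n, entails Γ (if v n w then σ n else ¬ σ n)) ->
  entails Γ (if forces v w A then subst σ A else ¬ subst σ A).
Proof.
intros Hw HΓ.
(* A maximal world sees only itself, so its connectives are classical. *)
assert (Himp : forall B C,
  forces v w (B → C) = implb (forces v w B) (forces v w C)).
{ intros B C; apply bool_iff; rewrite forces_imp; split.
  - intros H; specialize (H w (acc_refl _ w)).
    destruct (forces v w B); simpl; auto.
  - intros H u Hu; rewrite (Hw u Hu); intros HB; now rewrite HB in H. }
assert (Hneg : forall B, forces v w (¬ B) = negb (forces v w B)).
{ intros B; apply bool_iff; rewrite forces_neg; split.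
  - intros H; specialize (H w (acc_refl _ w)).
    destruct (forces v w B); simpl; auto; now destruct H.
  - intros H u Hu; rewrite (Hw u Hu); intros HB; now rewrite HB in H. }
induction A as [n|A IHA B IHB|A IHA B IHB|A IHA B IHB|A IHA].
- apply HΓ.
- simpl; destruct (forces v w A); [destruct (forces v w B)|]; simpl.
  + now apply entails_and.
  + eapply entails_cut; [exact IHB|].
    apply entails_neg, entails_andL, entails_absurd with (subst σ B); hyp.
  + eapply entails_cut; [exact IHA|].
    apply entails_neg, entails_andL, entails_absurd with (subst σ A); hyp.
- simpl; destruct (forces v w A); [|destruct (forces v w B)]; simpl.
  + now apply entails_or1.
  + now apply entails_or2.
  + eapply entails_cut; [exact IHA|].
    eapply entails_cut;
      [apply entails_incl with (2 := IHB); now right|].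
    apply entails_neg, entails_orL;
      [apply entails_absurd with (subst σ A) |
       apply entails_absurd with (subst σ B)]; hyp.
- rewrite Himp; destruct (forces v w A); [destruct (forces v w B)|]; simpl.
  + apply entails_imp, entails_incl with (2 := IHB); now right.
  + eapply entails_cut; [exact IHA|].
    eapply entails_cut; [apply entails_incl with (2 := IHB); now right|].
    apply entails_neg, entails_absurd with (subst σ B); [hyp|].
    apply entails_mp with (subst σ A); hyp.
  + eapply entails_cut; [exact IHA|].
    apply entails_imp, entails_absurd with (subst σ A); hyp.
- rewrite Hneg; destruct (forces v w A); simpl; [|exact IHA].
  eapply entails_cut; [exact IHA|].
  apply entails_neg, entails_absurd with (subst σ A); hyp.
Qed.

(* The three maximal worlds realise all classical valuations of [p] and
   [p ∧ q]. *)
Lemma neg_disj_complete (A : formula) :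
  neg_disj A -> forces generic (M123 : med) A = true -> KP (subst collapse A).
Proof.
induction 1 as [A|A B _ IHA _ IHB]; intros H.
- rewrite forces_neg in H.
  (* The root forces [¬ A], so [A] fails at each maximal world, and Kalmár's lemma refutes it in the
     matching context. *)
  assert (K : forall w Γ, (forall u : med, acc (w : med) u = true -> u = w) ->
    (forall n, entails Γ (if generic n w then collapse n else ¬ collapse n)) ->
    entails Γ (¬ subst collapse A)).
  { intros w Γ Hw HΓ.
    generalize (entails_maximal generic w Γ collapse A Hw HΓ).
    destruct (forces generic (w : med) A) eqn:E; [|easy].
    exfalso; apply (H w); [now destruct w | exact E]. }
  assert (K1 : entails [¬ p] (¬ subst collapse A)).
  { apply (K M1); [now intros [] | intros [|n]; simpl; [hyp|]].
    apply entails_neg, entails_andL, entails_absurd with p; hyp. }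
  assert (K2 : entails [¬ q; p] (¬ subst collapse A)).
  { apply (K M2); [now intros [] | intros [|n]; simpl; [hyp|]].
    apply entails_neg, entails_andL, entails_absurd with q; hyp. }
  assert (K3 : entails [q; p] (¬ subst collapse A)).
  { apply (K M3); [now intros [] | intros [|n]; simpl; [hyp|]].
    apply entails_and; hyp. }
  (* As in Glivenko's theorem, the case distinction on [p] and [q] is available when the goal is a
     negation: under the collapsed [A], the last two contexts yield [¬ p], and the first then
     refutes it. *)
  simpl; apply entails_nil, entails_neg.
  assert (Hp : entails [p; subst collapse A] (¬ p)).
  { apply entails_cut with (¬ q).
    - apply entails_neg, entails_absurd with (subst collapse A); [|hyp].
      apply entails_incl with (2 := K3).
      intros B [<- | [<- | []]]; simpl; auto.
    - apply entails_absurd with (subst collapse A); [|hyp].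
      apply entails_incl with (2 := K2).
      intros B [<- | [<- | []]]; simpl; auto. }
  apply entails_cut with (¬ p); [now apply entails_neg|].
  apply entails_incl with (2 := K1); intros B [<- | []]; now left.
- apply forces_or in H; destruct H as [H | H].
  + apply entails_nil, entails_or1, entails_KP, IHA, H.
  + apply entails_nil, entails_or2, entails_KP, IHB, H.
Qed.

(** * The trident with a top *)

Inductive trident_world : Type := Root | Mid1 | Mid2 | Mid3 | Top.

Definition trident_acc (w u : trident_world) : bool :=
  match w, u with
  | Root, _ | _, Top | Mid1, Mid1 | Mid2, Mid2 | Mid3, Mid3 => true
  | _, _ => false
  end.

Definition trident : frame.
Proof.
refine (Frame trident_world trident_acc [Root; Mid1; Mid2; Mid3; Top] _ _ _).
- intros []; simpl; tauto.
- intros []; reflexivity.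
- intros [] [] []; reflexivity || discriminate.
Defined.

(** A pair goes to the middle world indexed by its missing point. *)
Definition med_to_trident (w : med) : trident :=
  match w with
  | M123 => Root
  | M12 => Mid3
  | M13 => Mid2
  | M23 => Mid1
  | _ => Top
  end.

Lemma forces_med_to_trident (v : nat -> trident -> bool) (w : med)
    (A : formula) :
  forces (fun n u => v n (med_to_trident u)) w A =
  forces v (med_to_trident w) A.
Proof.
apply forces_p_morphism.
- intros [] []; reflexivity || discriminate.
- intros [] []; try discriminate; intros _;
    solve [ exists M1; now split | exists M2; now split | exists M3; now split
          | exists M12; now split | exists M13; now split
          | exists M23; now split | exists M123; now split ].
Qed.

(* [singleton w] is forced under [generic] at the maximal world outside [w],
   and [cone w] exactly at the preimage of the cone of [w]. *)
Definition singleton (w : trident_world) : formula :=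
  match w with
  | Mid1 => ¬ p
  | Mid2 => ¬ (¬ p ∨ q)
  | Mid3 => ¬ ¬ q
  | _ => ¬ (p → p)
  end.

Definition cone (w : trident_world) : formula :=
  match w with
  | Root => ¬ ¬ (p → p)
  | Top => singleton Mid1 ∨ (singleton Mid2 ∨ singleton Mid3)
  | _ => ¬ singleton w ∨ singleton w
  end.

(** An upset is the union of the cones of its members. The absurdity is written [¬ (p → p)] so that
    the whole remains a disjunction of negations. *)
Definition upset (U : trident_world -> bool) : formula :=
  let part w := if U w then cone w else ¬ (p → p) in
  part Root ∨ (part Mid1 ∨ (part Mid2 ∨ (part Mid3 ∨ part Top))).

Lemma neg_disj_upset (U : trident_world -> bool) : neg_disj (upset U).
Proof.
unfold upset; destruct (U Root), (U Mid1), (U Mid2), (U Mid3), (U Top);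
  repeat constructor.
Qed.

Lemma forces_upset (v : nat -> trident -> bool) (n : nat) (w : med) :
  persistent v -> forces generic w (upset (v n)) = v n (med_to_trident w).
Proof.
intros Hv; specialize (Hv n); unfold upset.
generalize (Hv Root Mid1 eq_refl) (Hv Root Mid2 eq_refl)
  (Hv Root Mid3 eq_refl) (Hv Mid1 Top eq_refl) (Hv Mid2 Top eq_refl)
  (Hv Mid3 Top eq_refl).
destruct w; simpl;
destruct (v n Root), (v n Mid1), (v n Mid2), (v n Mid3), (v n Top);
  intuition congruence.
Qed.

Definition holds (v : nat -> trident -> bool) (A : formula) : Prop :=
  forces v (Root : trident) A = true.

Definition valid_rule (ρ : rule) : Prop :=
  forall v, persistent v -> (forall B, In B (fst ρ) -> holds v B) ->
  holds v (snd ρ).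

Lemma holds_KP (v : nat -> trident -> bool) (A : formula) :
  persistent v -> KP A -> holds v A.
Proof.
intros Hv HA; unfold holds.
change (Root : trident) with (med_to_trident M123).
rewrite <- forces_med_to_trident; apply KP_sound; [|exact HA].
intros n w u Hwu; apply Hv; clear - Hwu; revert Hwu.
destruct w, u; reflexivity || discriminate.
Qed.

(** The substitution [σ] transfers [v] to the Medvedev frame under [generic]. Premises true in the
    trident then become disjunctions of negations true at the root, hence provable after [collapse];
    admissibility proves the conclusion, and soundness brings it back to [v]. *)
Lemma admissible_valid (ρ : rule) : admissible KP_system ρ -> valid_rule ρ.
Proof.
destruct ρ as [Γ A]; intros Hadm v Hv HΓ; simpl in *.
set (σ := fun n => upset (v n)).
assert (Hσ : forall B, holds v B <-> forces generic (M123 : med) (subst σ B) = true).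
{ intros B; unfold holds.
  change (Root : trident) with (med_to_trident M123).
  rewrite <- forces_med_to_trident, forces_subst.
  erewrite forces_ext; [reflexivity|].
  intros n w; symmetry; now apply forces_upset. }
(* Inserting [collapse] leaves forcing under [generic] unchanged and makes [neg_disj_complete]
   applicable. *)
apply Hσ; rewrite <- forces_collapse.
apply KP_sound; [apply generic_persistent|].
rewrite subst_subst; apply KP_admissible with (1 := Hadm).
intros B HB; rewrite <- subst_subst.
destruct (has_neg_disj_subst σ B) as (C & HC & HBC & HCB);
  [intros n; apply neg_disj_upset|].
apply entails_imp, entails_nil in HBC, HCB.
apply (KP_mp (subst collapse C)).
- exact (KP_subst collapse _ HCB).
- apply neg_disj_complete; [exact HC|].
  assert (H := KP_sound generic (M123 : med) _ generic_persistent HBC).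
  rewrite forces_imp in H; apply H; [reflexivity | now apply Hσ, HΓ].
Qed.

Lemma derives_valid (S : deductive_system) (Γ : list formula) (A : formula) :
  (forall B, axioms S B -> KP B) -> (forall ρ, rules S ρ -> valid_rule ρ) ->
  derives S Γ A -> valid_rule (Γ, A).
Proof.
intros HAx HR H v Hv HΓ; simpl in HΓ |- *; revert A H.
apply derives_ind; [exact HΓ| |].
- intros A (C & σ & HC & ->); now apply holds_KP, KP_subst, HAx.
- intros Δ A (Δ0 & C & σ & HC & -> & ->) H.
  unfold holds in *; simpl; rewrite forces_subst.
  apply (HR _ HC); [now apply persistent_subst|].
  intros B HB; unfold holds; rewrite <- forces_subst.
  now apply H, in_map.
Qed.

(** * A deductive extension that is not structurally complete *)

(** With all valid rules primitive, derivability coincides with validity: a valid rule is applied in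
    one step. *)
Definition trident_system : deductive_system := {|
  axioms := KP;
  rules := valid_rule;
  axioms_nonempty := ex_intro _ kreisel_putnam KP_axiom;
  rules_nonempty :=
    ex_intro _ mp (admissible_valid mp (rules_admissible KP_system mp eq_refl))
|}.

Lemma trident_system_sound (Γ : list formula) (A : formula) :
  derives trident_system Γ A -> valid_rule (Γ, A).
Proof. now apply derives_valid. Qed.

Lemma trident_system_complete (Γ : list formula) (A : formula) :
  valid_rule (Γ, A) -> derives trident_system Γ A.
Proof.
intros H; apply derives_rule_instance with (Δ := Γ); [|now left].
exists Γ, A, Var; rewrite subst_Var, map_subst_Var; auto.
Qed.

Lemma trident_system_extension :
  deductive_extension (structural_completion KP_system) trident_system.
Proof.
intros Γ A H; apply trident_system_complete; revert H.
apply derives_valid; [easy | exact admissible_valid].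
Qed.

(* The premises describe the three middle worlds: in the intended valuation
   [p], [q], [r] hold exactly at [Mid1], [Mid2], [Mid3] besides [Top]. *)
Definition trident_premises : list formula :=
  [(p → q) → q ∨ r; (p → r) → r ∨ q; (q → p) → p ∨ r;
   (q → r) → r ∨ p; (r → p) → p ∨ q; (r → q) → q ∨ p;
   p ∧ q → r; p ∧ r → q; q ∧ r → p].

Definition trident_rule : rule := (trident_premises, p ∨ q ∨ r).

Lemma trident_rule_not_valid : ~ valid_rule trident_rule.
Proof.
intros H.
set (v := fun n (w : trident) => match n, w with
  | _, Top | 0, Mid1 | 1, Mid2 | 2, Mid3 => true
  | _, _ => false
  end).
enough (E : holds v (p ∨ q ∨ r)) by discriminate E.
apply H.
- intros [|[|[|n]]] [] []; reflexivity || discriminate.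
- intros B HB; simpl in HB.
  decompose [or] HB; subst; reflexivity || contradiction.
Qed.

Definition merge (w : trident) : trident :=
  match w with Mid3 => Mid2 | _ => w end.

Lemma merge_persistent (v : nat -> trident -> bool) :
  persistent v -> persistent (fun n w => v n (merge w)).
Proof.
intros Hv n w u Hwu; apply Hv; revert Hwu.
destruct w, u; reflexivity || discriminate.
Qed.

(** Away from [Root], [merge] satisfies both p-morphism conditions. At [Root] the back condition
    fails, since [Mid3] is not in the image. *)
Lemma forces_merge (v : nat -> trident -> bool) (w : trident) (A : formula) :
  w <> Root -> forces (fun n u => v n (merge u)) w A = forces v (merge w) A.
Proof.
revert w; induction A as [n|A IHA B IHB|A IHA B IHB|A IHA B IHB|A IHA];
  intros w Hw; [easy| | | |]; simpl.
- now rewrite IHA, IHB.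
- now rewrite IHA, IHB.
- destruct w; simpl; rewrite ?IHA, ?IHB; easy.
- destruct w; simpl; rewrite ?IHA; easy.
Qed.

(* If [p], [q], [r] all fail at [Root], the premises make them hold separately
   at the three middle worlds.  Merging two of these confines one formula,
   say [r], to [Top]; then [r → p] holds at [Root] although [p ∨ q] does not. *)
Lemma trident_rule_merge (v v' : nat -> trident -> bool) :
  persistent v -> persistent v' ->
  (forall n w, w <> Root -> v' n w = v n (merge w)) ->
  (forall B, In B trident_premises -> holds v B) ->
  (forall B, In B trident_premises -> holds v' B) ->
  holds v (p ∨ q ∨ r).
Proof.
intros Hv Hv' E H H'.
assert (Hmid : forall n w, v n w = true -> v n Top = true)
  by (intros n []; apply Hv; reflexivity).
assert (E1 : forall n, v' n Mid1 = v n Mid1) by (intros n; now apply (E n Mid1)).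
assert (E2 : forall n, v' n Mid2 = v n Mid2) by (intros n; now apply (E n Mid2)).
assert (E3 : forall n, v' n Mid3 = v n Mid2) by (intros n; now apply (E n Mid3)).
assert (E4 : forall n, v' n Top = v n Top) by (intros n; now apply (E n Top)).
assert (Hroot : forall n, v' n Root = true -> v n Mid1 = true /\ v n Mid2 = true).
{ intros n Hn; rewrite <- E1, <- E2; split; revert Hn; apply Hv'; reflexivity. }
clear Hv Hv' E; unfold holds in *.
(* Both families of premises are packed into one boolean, which evaluation expresses through the
   values of [v] and the values of [v'] at [Root]. *)
assert (K : forall B, In B trident_premises ->
  forces v (Root : trident) B && forces v' (Root : trident) B = true)
  by (intros B HB; now rewrite H, H').
rewrite <- forallb_forall in K; clear H H'.
cbn in K |- *; rewrite ?E1, ?E2, ?E3, ?E4 in K; clear E1 E2 E3 E4.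
generalize (Hmid 0 Mid1) (Hmid 0 Mid2) (Hmid 0 Mid3) (Hmid 1 Mid1) (Hmid 1 Mid2)
  (Hmid 1 Mid3) (Hmid 2 Mid1) (Hmid 2 Mid2) (Hmid 2 Mid3)
  (Hroot 0) (Hroot 1) (Hroot 2).
clear Hmid Hroot.
destruct (v 0 Root); [easy|]; destruct (v 1 Root); [easy|];
destruct (v 2 Root); [easy|]; simpl in K.
(* Fixing the values world by world discards early the cases that already falsify a premise. *)
destruct (v 0 Mid1), (v 1 Mid1), (v 2 Mid1); simpl in K;
  rewrite ?andb_false_r in K; try discriminate K;
destruct (v 0 Mid2), (v 1 Mid2), (v 2 Mid2); simpl in K;
  rewrite ?andb_false_r in K; try discriminate K;
destruct (v 0 Mid3), (v 1 Mid3), (v 2 Mid3); simpl in K;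
  rewrite ?andb_false_r in K; try discriminate K;
destruct (v 0 Top), (v 1 Top), (v 2 Top); simpl in K;
  rewrite ?andb_false_r in K; try discriminate K; try (intuition congruence);
destruct (v' 0 Root), (v' 1 Root), (v' 2 Root); try discriminate K;
  intuition congruence.
Qed.

(** When the new rule is applied in a proof without hypotheses, its premises hold under every
    persistent valuation, in particular under [v] and under [v] composed with [merge]; this is what
    [trident_rule_merge] requires. *)
Lemma trident_rule_admissible : admissible trident_system trident_rule.
Proof.
intros A; split; intros H.
- apply trident_system_complete.
  (* The induction must range over all valuations, since the new rule calls on the merged one. *)
  enough (H' : forall v, persistent v -> holds v A) by (intros v Hv _; auto).
  revert A H.
  apply (derives_ind _ _ (fun A => forall v, persistent v -> holds v A)); [easy| |].
  + intros A (C & σ & HC & ->) v Hv; now apply holds_KP, KP_subst.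
  + intros Δ A (Δ0 & C & σ & [HC | HC] & -> & ->) H v Hv.
    * unfold holds in *; simpl; rewrite forces_subst.
      apply HC; [now apply persistent_subst|].
      intros B HB; unfold holds; rewrite <- forces_subst.
      now apply H; [apply in_map|].
    * injection HC as -> ->.
      unfold holds; rewrite forces_subst.
      apply trident_rule_merge with
        (* The substituted formulas are evaluated anew under the merged valuation, so their values
           at [Root] may differ from those under [v]. *)
        (fun n w => forces (fun n u => v n (merge u)) w (σ n)).
      -- now apply persistent_subst.
      -- now apply persistent_subst, merge_persistent.
      -- intros n w Hw; now apply forces_merge.
      -- intros B HB; unfold holds; rewrite <- forces_subst.
         apply H; [now apply in_map | exact Hv].
      -- intros B HB; unfold holds; rewrite <- forces_subst.
         apply H; [now apply in_map | now apply merge_persistent].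
- apply trident_system_sound in H.
  apply derives_rule_instance with (Δ := []); [|easy].
  exists [], A, Var; rewrite subst_Var; simpl; auto.
Qed.

Theorem corollary5p20 :
  ~ hereditarily_structurally_complete (structural_completion KP_system).
Proof.
intros [_ H].
apply trident_rule_not_valid, trident_system_sound.
exact (H _ trident_system_extension _ trident_rule_admissible).
Qed.
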